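(* Let $X$ be a real-valued random variable with distribution function $F(x)=\mathbb{P}(X\le x)$, $-\infty<x<\infty$, and let $\{X_n;\ n\ge 1\}$ be a sequence of i.i.d. random variables with common distribution function $F$. Let $$\rho_1=\sup\left\{r\ge 0:\ \lim_{x\to\infty}x^r\,\mathbb{P}(X>x)=0\right\}\in[0,\infty].$$ Then $$\limsup_{n\to\infty}\frac{\log\max_{1\le k\le n}X_k}{\log n}=\frac{1}{\rho_1}\quad\text{almost surely},$$ and there exists an increasing sequence of positive integers $\{l_n;\ n\ge1\}$ (non-random, and depending on the probability distribution of $X$ when $\rho_1<\infty$) such that $$\lim_{n\to\infty}\frac{\log\max_{1\le k\le l_n}X_k}{\log l_n}=\frac{1}{\rho_1}\quad\text{almost surely}.$$
   Context: Convention: $\log x=\ln(e\vee x)=\ln\max(e,x)$ for all $-\infty<x<\infty$, where $\ln$ is the natural logarithm (so $\log x\ge 1$ always). Also $1/0=\infty$ and $1/\infty=0$; limits, limsups and liminfs are taken in $[0,\infty]$. An increasing sequence of integers means $l_1<l_2<\cdots$. *)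

(* Defs.v *)
From HB Require Import structures.
From mathcomp Require Import all_boot all_order all_algebra finmap.
From mathcomp Require Import all_classical all_reals all_analysis.

Set Implicit Arguments.
Unset Strict Implicit.
Unset Printing Implicit Defensive.

Import Order.TTheory GRing.Theory Num.Theory.
Import numFieldNormedType.Exports.

Local Open Scope classical_set_scope.
Local Open Scope ring_scope.

(* "log x" is ln (max (e, x)), so that log x >= 1 for every real x. *)
Definition log {R : realType} (x : R) : R := ln (Num.max (expR 1) x).

Definition mutually_independent {d : measure_display} {T : measurableType d}
    {R : realType} (P : probability T R) (X : nat -> {RV P >-> R}) : Prop :=
  forall (J : {fset nat}) (A : nat -> set R),
    (forall i, measurable (A i)) ->
    P (\bigcap_(i in [set` J]) X i @^-1` A i) =
    (\prod_(i <- J) P (X i @^-1` A i))%E.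

(* ccdf X x is P (X > x). *)
Definition rho1 {d : measure_display} {T : measurableType d} {R : realType}
    (P : probability T R) (X : {RV P >-> R}) : \bar R :=
  ereal_sup [set r%:E | r in
    [set r : R | 0 <= r /\
      ((x `^ r)%:E * ccdf X x)%E @[x --> +oo] --> (0 : \bar R)]].

(* Sequences are indexed from 0, so X k stands for X_(k+1), and running_max X n
   is the maximum of X_1, ..., X_n.  The value at n = 0 is a dummy. *)
Definition running_max {T : Type} {R : realType} (X : nat -> T -> R) (n : nat)
    (w : T) : R :=
  \big[Num.max/X 0%N w]_(k < n) X k w.

Definition log_max_ratio {T : Type} {R : realType} (X : nat -> T -> R)
    (n : nat) (w : T) : \bar R :=
  (log (running_max X n w) / log n%:R)%:E.

(* Main.v *)
(* Let M_n be the maximum of the first n variables and rho the tail exponent.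
   For r < rho, P (X > x) <= x^-s eventually for some s > r, so the probability
   that one of the first 2^(j+1) variables exceeds 2^(j/r) decays geometrically
   in j; by Borel-Cantelli M_n <= n^(1/r) for all large n, whence the limsup is
   at most 1/rho.
   For rho < m < q, x^m P (X > x) stays above some e > 0 along arbitrarily large
   x; with l about x^q, P (M_l <= x) <= exp (- l P (X > x)) is as small as
   desired.  Letting q decrease to rho along a sequence of such pairs (l, x)
   with summable probabilities gives M_(l_n) > x_n eventually, hence the ratio
   along l_n is asymptotically at least 1/rho.  Since it is also bounded by the
   limsup, both limits equal 1/rho. *)
Require Import Defs.
From HB Require Import structures.
From mathcomp Require Import all_boot all_order all_algebra finmap lra.
From mathcomp Require Import all_classical all_reals all_analysis.

Import Order.TTheory GRing.Theory Num.Theory.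
Import numFieldNormedType.Exports.

Local Open Scope classical_set_scope.
Local Open Scope ring_scope.

(** * Analytic and measure-theoretic tools *)

Lemma powR_cvgy (R : realType) (s : R) : 0 < s -> x `^ s @[x --> +oo] --> +oo.
Proof.
move=> s0; apply/cvgryPge => A; near=> x.
have B0 : 0 <= Num.max 0 A by rewrite le_max lexx.
have BA : A <= Num.max 0 A by rewrite le_max lexx orbT.
apply: (le_trans BA).
have -> : Num.max 0 A = (Num.max 0 A `^ s^-1) `^ s.
  by rewrite -powRrM mulVf ?gt_eqF// powRr1.
have Bx : Num.max 0 A `^ s^-1 <= x by near: x; exact: nbhs_pinfty_ge.
by apply: ge0_ler_powR; rewrite ?nnegrE ?powR_ge0 ?(ltW s0)// (le_trans _ Bx)// powR_ge0.
Unshelve. all: by end_near. Qed.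

(** The bound may fail below some rank [N]; shifting by [N] gives a series dominated by the
    geometric one, so the limsup set is null. *)
Lemma borel_cantelli_geometric {d : measure_display} {T : measurableType d}
    {R : realType} (mu : {measure set T -> \bar R}) (A : nat -> set T) (C z : R) :
  (forall n, measurable (A n)) -> 0 <= C -> 0 <= z < 1 ->
  (\forall n \near \oo, (mu (A n) <= (C * z ^+ n)%:E)%E) ->
  {ae mu, forall w, \forall n \near \oo, ~ A n w}.
Proof.
move=> mA C0 /andP[z0 z1] [N _ muA].
have summable : (\sum_(n <oo) mu (A (n + N)%N) < +oo)%E.
  apply: (@le_lt_trans _ _ (C / (1 - z))%:E); last by rewrite ltry.
  apply: lime_le; first exact: is_cvg_nneseries.
  apply: nearW => n.
  apply: (@le_trans _ _ (\sum_(0 <= k < n) (C * z ^+ k)%:E)%E).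
    apply: lee_sum => k _; apply: le_trans (muA _ _) _; first exact: leq_addl.
    by rewrite lee_fin ler_wpM2l// exprD ler_piMr ?exprn_ge0// exprn_ile1// ltW.
  rewrite sumEFin lee_fin.
  have /(congr1 (fun u => u n))/= := @geometric_seriesE R C z (negbT (lt_eqF z1)).
  rewrite /series/= => ->; rewrite ler_wpM2r ?invr_ge0 ?subr_ge0 ?(ltW z1)//.
  by rewrite ler_piMr// lerBlDr lerDl exprn_ge0.
have mAN k : measurable (A (k + N)%N) by [].
have null := lim_sup_set_cvg0 mAN summable.
exists (lim_sup_set (fun n => A (n + N)%N)); split => //.
  by apply: bigcap_measurable => // n _; apply: bigcup_measurable.
move=> w /= nw n _; apply: contrapT => noA; apply: nw.
exists (n + N)%N => // m /= nNm Am; apply: noA.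
exists (m - N)%N => /=; first by rewrite leq_subRL ?(leq_trans _ nNm) ?leq_addl// addnC.
by rewrite subnK// (leq_trans _ nNm)// leq_addl.
Qed.

(** Deterministic step that turns one-sided bounds into both limits. As [n <= l n], the upper bounds
    on [u] pass to the subsequence, which therefore converges to [c]; a subsequential limit in turn
    bounds the limsup from below. *)
Lemma limn_esup_eq_subseq_lim (R : realType) (u : nat -> R)
    (l : nat -> nat) (c : \bar R) :
  (forall n, 0 <= u n) ->
  (forall m n, (m < n)%N -> (l m < l n)%N) ->
  (forall a : R, (c < a%:E)%E -> \forall n \near \oo, u n <= a) ->
  (forall b : R, (b%:E < c)%E -> \forall n \near \oo, b <= u (l n)) ->
  limn_esup (fun n => (u n)%:E) = c /\ (u (l n))%:E @[n --> \oo] --> c.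
Proof.
move=> u0 l_incr uc cl.
have le_l n : (n <= l n)%N.
  by elim: n => // n IH; rewrite (leq_ltn_trans IH)// l_incr.
have near_l (Q : nat -> Prop) : (\forall n \near \oo, Q n) -> \forall n \near \oo, Q (l n).
  by move=> [N _ NQ]; exists N => // n /= Nn; apply: NQ; rewrite /= (leq_trans Nn).
have c0 : (0 <= c)%E.
  rewrite leNgt; apply/negP => c0.
  case: c c0 uc {cl} => [r| |] // c0 uc.
  - have [|N _ /(_ N)] := uc (r / 2); first by move: c0; rewrite !lte_fin; lra.
    by move=> /(_ (leqnn _)); have := u0 N; move: c0; rewrite lte_fin; lra.
  - have [|N _ /(_ N)] := uc (-1); first by rewrite ltNyr.
    by move=> /(_ (leqnn _)); have := u0 N; lra.
have ul : (u (l n))%:E @[n --> \oo] --> c.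
  case: c c0 uc cl => [r| |] // c0 uc cl.
  - apply/fine_cvgP; split; first exact: nearW.
    apply/cvgrPdist_le => e e0 /=.
    have ub : \forall n \near \oo, u (l n) <= r + e.
      by apply/(near_l (fun k => u k <= r + e))/uc; rewrite lte_fin ltrDl.
    have lb : \forall n \near \oo, r - e <= u (l n).
      by apply: cl; rewrite lte_fin ltrBlDr ltrDl.
    near=> n; rewrite ler_distlC; apply/andP; split; first by near: n.
    by near: n.
  - by apply/cvgeyPge => A; have := cl A (ltry _); apply: filterS => n; rewrite lee_fin.
split => //; apply/eqP; rewrite eq_le; apply/andP; split.
  have le_a (a : R) : (c < a%:E)%E -> (limn_esup (fun n => (u n)%:E) <= a%:E)%E.
    move=> /uc ua; apply: (@le_trans _ _ (ereal_sup [set (u n)%:E | n in [set n | u n <= a]])).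
      by apply: ereal_inf_lbound; exists [set n | u n <= a].
    by apply: ge_ereal_sup => _ [n /= una <-]; rewrite lee_fin.
  case: c c0 {uc cl ul} le_a => [r| |] // c0 le_a; last by rewrite leey.
  by apply/lee_addgt0Pr => e e0; rewrite -EFinD; apply: le_a; rewrite lte_fin ltrDl.
(* The limsup is an infimum over sets [V] of the filter; the preimage of [V] under [l] is again in
   the filter. *)
apply: le_ereal_inf_tmp => _ [V V_oo <-].
have [_ <-] := cvg_limn_einf_sup ul.
apply: (@le_trans _ _ (ereal_sup [set (u (l n))%:E | n in [set n | V (l n)]])).
  by apply: ereal_inf_lbound; exists [set n | V (l n)] => //; exact: near_l.
by apply: ereal_sup_le => _ [n Vn <-]; exists (l n).
Unshelve. all: by end_near. Qed.

(** * Tail exponent and power bounds on the tail *)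

(** Depends on a distribution function only, so that the sequence can be chosen before the random
    variables. *)
Definition tail_exponent {R : realType} (F : R -> \bar R) : \bar R :=
  ereal_sup [set r%:E | r in
    [set r : R | 0 <= r /\
      ((x `^ r)%:E * (1 - F x))%E @[x --> +oo] --> (0 : \bar R)]].

Lemma log_id {R : realType} (x : R) : expR 1 <= x -> log x = ln x.
Proof. by move=> ex; rewrite /log max_r. Qed.

Lemma log_ge1 {R : realType} (x : R) : 1 <= log x.
Proof. by rewrite /log -[leLHS]expRK ler_ln ?posrE ?lt_max ?expR_gt0// le_max lexx. Qed.

Lemma le_log {R : realType} : {homo @log R : x y / x <= y}.
Proof.
move=> x y xy; rewrite /log ler_ln ?posrE ?lt_max ?expR_gt0//.
by rewrite ge_max !le_max lexx/= xy orbT.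
Qed.

Section tail.
Context {d : measure_display} {T : measurableType d} {R : realType}
  {P : probability T R} (X : {RV P >-> R}).

Lemma rho1E : rho1 X = tail_exponent (cdf X).
Proof.
rewrite /rho1.
by have -> : ccdf X = (fun x => (1 - cdf X x)%E) by apply/funext => x; rewrite ccdf_1_cdf.
Qed.

Lemma cdf_fine x : cdf X x = (fine (cdf X x))%:E.
Proof. by rewrite fineK// fin_num_measure. Qed.

Lemma ccdf_fine x : ccdf X x = (1 - fine (cdf X x))%:E.
Proof. by rewrite ccdf_1_cdf [in LHS]cdf_fine. Qed.

Lemma rho1_ge0 : (0 <= rho1 X)%E.
Proof.
apply: ereal_sup_ubound; exists 0 => //; split=> //.
by under eq_fun do rewrite powRr0 mul1e; exact: cvg_ccdfy0.
Qed.

Lemma ccdf_le_powR (r : R) : 0 <= r -> (r%:E < rho1 X)%E ->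
  exists2 s, r < s & \forall x \near +oo, (ccdf X x <= (x `^ (- s))%:E)%E.
Proof.
move=> r0 /ereal_sup_gt[_ [s [s0 tail0] <-] rs]; exists s; first by rewrite -lte_fin.
move/fine_cvgP : tail0 => [_ /cvgrPdist_le/(_ 1 ltr01)] /= tail1.
near=> x.
have x0 : 0 < x by near: x; exact: nbhs_pinfty_gt.
rewrite ccdf_fine lee_fin powRN -[leRHS]mul1r ler_pdivlMr ?powR_gt0// mulrC.
apply: le_trans (ler_norm _) _; rewrite -normrN -[X in `|X|]sub0r.
by near: x; move: tail1; apply: filterS => x; rewrite ccdf_fine.
Unshelve. all: by end_near. Qed.

(** Otherwise x^m P (X > x) would tend to 0, and [m] would belong to the set whose supremum is
    [rho1 X]. *)
Lemma ccdf_ge_powR (m : R) : 0 <= m -> (rho1 X < m%:E)%E ->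
  exists2 e, 0 < e & forall A : R, exists2 x, A < x & e <= x `^ m * fine (ccdf X x).
Proof.
move=> m0 rhom; apply: contrapT => no_e.
suff : (m%:E <= rho1 X)%E by rewrite leNgt rhom.
apply: ereal_sup_ubound; exists m => //; split=> //.
apply/fine_cvgP; split; first by apply: nearW => x; rewrite ccdf_fine.
apply/cvgrPdist_le => e e0 /=; apply: contrapT => not_near; apply: no_e.
exists e => // A; apply: contrapT => noA; apply: not_near.
near=> x.
have Ax : A < x by near: x; apply: nbhs_pinfty_gt; exact: num_real.
rewrite sub0r normrN ccdf_fine /= ger0_norm; last first.
  by rewrite mulr_ge0 ?powR_ge0// -lee_fin -ccdf_fine.
rewrite leNgt; apply/negP => ex; apply: noA; exists x => //.
by rewrite ccdf_fine/= ltW.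
Unshelve. all: by end_near. Qed.

(** Take l = floor (x^q) and [m] midway between rho and [q]. Along suitable x, l P (X > x) is at
    least e x^(q-m) / 2, which is unbounded. *)
Lemma cdf_pow_small (q del : R) (N : nat) :
  (rho1 X < q%:E)%E -> 0 < del ->
  exists lx : nat * R, [/\ (N < lx.1)%N, fine (cdf X lx.2) ^+ lx.1 <= del &
    log lx.1%:R <= q * log lx.2].
Proof.
move=> rhoq del0.
have rho_fin : rho1 X \is a fin_num.
  by rewrite ge0_fin_numE ?rho1_ge0// (lt_trans rhoq)// ltry.
pose rho := fine (rho1 X); have rhoE : rho1 X = rho%:E by rewrite fineK.
have rho0 : 0 <= rho by rewrite fine_ge0// rho1_ge0.
move: rhoq; rewrite rhoE lte_fin => rhoq.
have q0 : 0 < q by lra.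
pose m := (rho + q) / 2; have mq : m < q by rewrite /m; lra.
have [||e e0 tail_ge] := @ccdf_ge_powR m; first by rewrite /m; lra.
  by rewrite rhoE lte_fin /m; lra.
pose y := - ln del.
(* In order: the first two remove the truncation in [log], the third gives l > N, the fourth l >=
   x^q / 2, and the last makes the exponent reach [y]. *)
have [A [_ largeA]] : \forall x \near +oo,
    [/\ expR 1 <= x, expR 1 <= x `^ q, N.+1%:R <= x `^ q, 2 <= x `^ q &
        2 * y / e <= x `^ (q - m)].
  have pow_near s B : 0 < s -> \forall x \near +oo, B <= x `^ s :> R.
    by move=> s0; move/cvgryPge : (powR_cvgy _ _ s0); apply.
  near=> x; split; near: x; try exact: pow_near.
  - exact: nbhs_pinfty_ge.
  - by apply: pow_near; rewrite subr_gt0.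
have [x Ax tailx] := tail_ge A.
have [ex exq Nxq xq2 yxq] := largeA _ Ax.
have x0 : 0 < x by rewrite (lt_le_trans _ ex)// expR_gt0.
have xq0 : 0 <= x `^ q by exact: powR_ge0.
exists (Num.truncn (x `^ q), x) => /=; split.
- by rewrite truncn_ge_nat.
- set l := Num.truncn _; set p := fine (cdf X x).
  have := truncn_itv xq0; rewrite -/l -natr1 => /andP[lx xl].
  have p0 : 0 <= p by rewrite -lee_fin -cdf_fine.
  have pE : p <= expR (- (1 - p)) by apply: le_trans (expR_ge1Dx _); lra.
  apply: (@le_trans _ _ (expR (- (1 - p)) ^+ l)); first by rewrite lerXn2r// nnegrE expR_ge0.
  rewrite -expRM_natl -[leRHS]lnK ?posrE// ler_expR mulrN lerNl -/y.
  move: tailx; rewrite ccdf_fine/= -/p => tailx.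
  have xq_half : x `^ q / 2 <= l%:R by lra.
  have p1 : 0 <= 1 - p by rewrite -lee_fin -ccdf_fine.
  apply: (@le_trans _ _ (x `^ q / 2 * (1 - p))); last by rewrite ler_wpM2r.
  have -> : x `^ q = x `^ (q - m) * x `^ m.
    by rewrite -powRD ?subrK// (gt_eqF x0) implybT.
  rewrite mulrAC -(mulrA _ (x `^ m)) ler_pdivlMr// mulrC.
  apply: (@le_trans _ _ (x `^ (q - m) * e)); first by rewrite -ler_pdivrMr.
  by rewrite ler_wpM2l ?powR_ge0.
- rewrite (log_id _ ex) -ln_powR -(log_id _ exq); apply: le_log.
  by rewrite truncn_le.
Unshelve. all: by end_near. Qed.

End tail.

(* With rho the tail exponent, P (M_(l n) <= x n) <= 2^-n while
   log (x n) / log (l n) is at least 1 / (rho + 1 / (n + 1)). *)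
Definition exceedance_seq {R : realType} (F : R -> \bar R) : set (nat -> nat) :=
  [set l | [/\ forall n, (0 < l n)%N, forall m n, (m < n)%N -> (l m < l n)%N &
    exists x : nat -> R, forall n, fine (F (x n)) ^+ l n <= 2^-1 ^+ n /\
      log (l n)%:R <= (fine (tail_exponent F) + n.+1%:R^-1) * log (x n)]].

Lemma exceedance_seq_ex {d : measure_display} {T : measurableType d} {R : realType}
    {P : probability T R} (X : {RV P >-> R}) :
  rho1 X != +oo%E -> exists l, exceedance_seq (cdf X) l.
Proof.
move=> rho_y.
have rho_fin : rho1 X \is a fin_num.
  by rewrite ge0_fin_numE ?rho1_ge0// lt_neqAle rho_y leey.
have step (nN : nat * nat) : exists lx : nat * R, [/\ (nN.2 < lx.1)%N,
    fine (cdf X lx.2) ^+ lx.1 <= 2^-1 ^+ nN.1 &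
    log lx.1%:R <= (fine (tail_exponent (cdf X)) + nN.1.+1%:R^-1) * log lx.2].
  apply: cdf_pow_small; last by rewrite exprn_gt0// invr_gt0.
  by rewrite -rho1E -[ltLHS]fineK// lte_fin ltrDl invr_gt0.
have [g gP] := choice step.
(* Each stage receives the previous index as its threshold, which forces strict growth; the initial
   threshold 0 gives l 0 > 0. *)
pose l := fix l n := (g (n, if n is k.+1 then l k else 0%N)).1.
pose x n := (g (n, if n is k.+1 then l k else 0%N)).2.
exists l; split.
- move=> [|n]; first by have [] := gP (0%N, 0%N).
  by have [/= /(leq_ltn_trans _) + _ _] := gP (n.+1, l n); apply.
- by apply: homo_ltn ltn_trans _ => n; have [] := gP (n.+1, l n).
- by exists x => -[|n]; [have [] := gP (0%N, 0%N) | have [] := gP (n.+1, l n)].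
Qed.

(** * Almost sure bounds on the maximum *)

Section iid.
Context {d : measure_display} {T : measurableType d} {R : realType}
  {P : probability T R} (X : {RV P >-> R}).
Context {d' : measure_display} {T' : measurableType d'}
  {P' : probability T' R} (Xs : nat -> {RV P' >-> R}).
Context (Xs_law : forall n, cdf (Xs n) = cdf X).

Lemma measurable_RV_preimage n (A : set R) : measurable A -> measurable (Xs n @^-1` A).
Proof. by move=> mA; rewrite -[X in measurable X]setTI; exact: measurable_funP. Qed.

(* The dyadic block [2^j, 2^(j+1)[ is controlled by the single event that one
   of the first 2^(j+1) variables exceeds (2^j)^(1/r). *)
Lemma ae_log_max_ratio_le (r : R) : 0 < r -> (r%:E < rho1 X)%E ->
  {ae P', forall w, \forall n \near \oo,
    log (running_max Xs n w) / log n%:R <= r^-1}.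
Proof.
move=> r0 /(ccdf_le_powR _ _ (ltW r0))[s rs tail_le].
pose x j : R := (2 ^ j)%:R `^ r^-1.
pose A j := \big[setU/set0]_(k < 2 ^ j.+1) (Xs k @^-1` `]x j, +oo[).
have natpow_ge (B : R) : \forall n \near \oo, B <= n%:R.
  by move/cvgryPge : (@cvgr_idn R); apply.
have pow_r_ge (B : R) : \forall n \near \oo, B <= n%:R `^ r^-1.
  have /cvgryPge/(_ B)[C [_ CB]] : y `^ r^-1 @[y --> +oo] --> (+oo : set_system R).
    by apply: powR_cvgy; rewrite invr_gt0.
  by have := natpow_ge (C + 1); apply: filterS => n Cn; apply: CB; lra.
have mA j : measurable (A j).
  by apply: bigsetU_measurable => k _; exact: measurable_RV_preimage.
(* The union bound for block j is 2^(j+1) (2^(j/r))^(-s) = 2 z^j, and s > r gives z < 1. *)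
pose z : R := 2 `^ (1 - s / r).
have z01 : 0 <= z < 1.
  rewrite powR_ge0/= /z.
  by rewrite /powR pnatr_eq0/= expR_lt1 pmulr_llt0 ?ln_gt0 ?ltr1n// subr_lt0 ltr_pdivlMr ?mul1r.
have PA_le : \forall j \near \oo, (P' (A j) <= (2 * z ^+ j)%:E)%E.
  have [B [_ tailB]] := tail_le.
  have [N _ NB] := pow_r_ge (B + 1).
  exists N => // j /= Nj.
  have xB : B < x j.
    apply: (@lt_le_trans _ _ (B + 1)); first by rewrite ltrDl.
    by apply: NB; rewrite /= (leq_trans Nj)// ltnW// ltn_expl.
  have union_bound := @Boole_inequality _ _ _ P' (fun k => Xs k @^-1` `]x j, +oo[) (2 ^ j.+1).
  apply: (le_trans (union_bound _)) => [k _|]; first exact: measurable_RV_preimage.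
  apply: (@le_trans _ _ (\sum_(k < 2 ^ j.+1) (x j `^ (- s))%:E)%E).
    apply: lee_sum => k _.
    have := tailB _ xB; rewrite ccdf_1_cdf -(Xs_law k) -ccdf_1_cdf; exact.
  rewrite sumEFin lee_fin sumr_const card_ord -[leLHS]mulr_natl /z.
  rewrite -powR_mulrn ?powR_ge0//.
  rewrite -powRrM mulrBl mul1r powRD; last by rewrite pnatr_eq0 implybT.
  rewrite [in 2 `^ j%:R]powR_mulrn// mulrA natrX exprS ler_pM2l ?mulr_gt0 ?exprn_gt0//.
  by rewrite /x natrX -powR_mulrn// -!powRrM mulrN mulrN [_ / r]mulrC [j%:R * _]mulrC.
have := borel_cantelli_geometric P' _ _ _ mA (ler0n _ 2) z01 PA_le.
apply: filterS => w [J _ AJ].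
have := pow_r_ge (expR 1); have := natpow_ge (expR 1); have := natpow_ge (2 ^ J)%:R.
apply: filterS3 => n; rewrite ler_nat => Jn en enr.
have n0 : (0 < n)%N by rewrite (leq_trans _ Jn)// expn_gt0.
have /andP[jn nj] := trunc_log_bounds (isT : (1 < 2)%N) n0.
set j := trunc_log 2 n in jn nj.
have Jj : (J <= j)%N by rewrite trunc_log_max.
have Xle k : (k < 2 ^ j.+1)%N -> Xs k w <= n%:R `^ r^-1.
  move=> kj; apply: (@le_trans _ _ (x j)); last first.
    by apply: ge0_ler_powR; rewrite ?nnegrE ?invr_ge0 ?(ltW r0)// ler_nat.
  rewrite leNgt; apply/negP => xX; apply: (AJ _ Jj).
  rewrite /A (bigD1 (Ordinal kj))//=; left.
  by rewrite /= in_itv/= xX.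
have max_le : running_max Xs n w <= n%:R `^ r^-1.
  apply: bigmax_le => [|k _]; first by rewrite Xle// expn_gt0.
  by rewrite Xle// (ltn_trans (ltn_ord k)).
rewrite ler_pdivrMr ?(lt_le_trans _ (log_ge1 _))// [in leRHS](log_id _ en) -ln_powR -(log_id _ enr).
exact: le_log.
Qed.

Context (Xs_indep : mutually_independent Xs).

(** The event avoids [running_max], whose dummy value would break the formula at l = 0. *)
Lemma running_max_prob (x : R) (l : nat) :
  P' [set w | forall k, (k < l)%N -> Xs k w <= x] = (fine (cdf X x) ^+ l)%:E.
Proof.
pose J : {fset nat} := [fset k | k in iota 0 l]%fset.
have memJ k : (k \in J) = (k < l)%N by rewrite !inE mem_iota.
have -> : [set w | forall k, (k < l)%N -> Xs k w <= x] =
    \bigcap_(i in [set` J]) Xs i @^-1` `]-oo, x].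
  apply/seteqP; split => w /= H k.
    by rewrite /= memJ in_itv/=; exact: H.
  by move=> kl; have := H k; rewrite /= memJ in_itv/=; apply.
rewrite (Xs_indep J (fun=> `]-oo, x]%classic))//.
rewrite (eq_bigr (fun=> (fine (cdf X x))%:E)); last first.
  by move=> k _; rewrite -(cdf_fine X) -(Xs_law k).
rewrite prodEFin big_const_seq count_predT iter_mulr_1 card_fseq undup_id ?iota_uniq//.
by rewrite size_iota.
Qed.

Lemma ae_le_log_max_ratio (l : nat -> nat) : exceedance_seq (cdf X) l ->
  {ae P', forall w, forall b : R, (b%:E < (rho1 X)^-1)%E -> \forall n \near \oo,
    b <= log (running_max Xs (l n) w) / log (l n)%:R}.
Proof.
move=> [l_gt0 l_incr [x xP]].
pose A n := [set w | forall k, (k < l n)%N -> Xs k w <= x n].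
have mA n : measurable (A n).
  rewrite /A (_ : mkset _ = \bigcap_(k in `I_(l n)) Xs k @^-1` `]-oo, x n]).
    apply: bigcap_measurable => [|k _]; first by exists 0%N; exact: l_gt0.
    exact: measurable_RV_preimage.
  by apply/seteqP; split => w /= H k /H; rewrite /= in_itv/=.
have half01 : 0 <= (2^-1 : R) < 1 by rewrite invr_ge0 ler0n/= invf_lt1// ltr1n.
have PA_le : \forall n \near \oo, (P' (A n) <= (1 * 2^-1 ^+ n)%:E)%E.
  by apply: nearW => n; rewrite mul1r running_max_prob lee_fin; have [] := xP n.
apply: filterS (borel_cantelli_geometric P' _ _ _ mA ler01 half01 PA_le).
move=> w nA b b_lt.
have rho0 := rho1_ge0 X.
(* The ratio is nonnegative, so only b > 0 matters, where b < 1 / rho can be inverted to rho < 1 /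
   b. *)
case: (leP b 0) => [b0|b0].
  apply: nearW => n; apply: (le_trans b0).
  by rewrite divr_ge0// (le_trans ler01 (log_ge1 _)).
have rho_b : (rho1 X < (b^-1)%:E)%E.
  by move: b_lt; rewrite inve_pgt ?inE ?lee_fin ?(ltW b0)// inver gt_eqF.
have rho_fin : rho1 X \is a fin_num by rewrite ge0_fin_numE// (lt_trans rho_b)// ltry.
move: rho_b; rewrite -(fineK rho_fin) lte_fin -subr_gt0 => rho_b.
have := near_infty_natSinv_lt (PosNum rho_b).
apply: filterS2 nA => n /= nA n_large.
have log_gt0 (y : R) : 0 < log y by rewrite (lt_le_trans ltr01 (log_ge1 _)).
rewrite ler_pdivlMr// -ler_pdivlMl//.
have [_ +] := xP n; rewrite -rho1E => /le_trans; apply.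
apply: ler_pM; rewrite ?addr_ge0 ?fine_ge0 ?invr_ge0 ?(ltW (log_gt0 _))//.
  by move: n_large; rewrite ltrBrDl => /ltW.
apply: le_log; rewrite leNgt; apply/negP => max_lt; apply: nA => k kl.
by rewrite (le_trans _ (ltW max_lt))// /running_max (le_bigmax _ _ (Ordinal kl)).
Qed.

End iid.

(* The non-random sequence is obtained from the distribution function of X
   alone, and is the same sequence l0 for all X with rho1 X = +oo. *)
Theorem theorem2p1 (R : realType) :
  exists (l : (R -> \bar R) -> nat -> nat) (l0 : nat -> nat),
  forall (d : measure_display) (T : measurableType d) (P : probability T R)
    (X : {RV P >-> R}),
  [/\ forall n, (0 < l (cdf X) n)%N,
      forall m n, (m < n)%N -> (l (cdf X) m < l (cdf X) n)%N,
      rho1 X = +oo%E -> l (cdf X) = l0 &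
      forall (d' : measure_display) (T' : measurableType d')
        (P' : probability T' R) (Xs : nat -> {RV P' >-> R}),
      mutually_independent Xs ->
      (forall n, cdf (Xs n) = cdf X) ->
      {ae P', forall w,
         limn_esup (fun n => log_max_ratio Xs n w) = (rho1 X)^-1%E} /\
      {ae P', forall w,
         log_max_ratio Xs (l (cdf X) n) w @[n --> \oo] --> (rho1 X)^-1%E}].
Proof.
pose l0 n := n.+1.
(* For an infinite exponent the target is 0 and any increasing sequence works; otherwise the default
   of [xget] is never reached. *)
exists (fun F => if tail_exponent F == +oo%E then l0 else xget l0 (exceedance_seq F)), l0.
move=> d T P X; rewrite -rho1E; set l := if _ then _ else _.
have [l_gt0 l_incr lP] : [/\ forall n, (0 < l n)%N, forall m n, (m < n)%N -> (l m < l n)%N &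
    rho1 X != +oo%E -> exceedance_seq (cdf X) l].
  rewrite /l; case: ifPn => [_|rho_y]; first by split.
  by have /(xgetPex l0)[*] := exceedance_seq_ex X rho_y; split.
split=> // [|d' T' P' Xs Xs_indep Xs_law]; first by rewrite /l => /eqP ->.
have log_gt0 (y : R) : 0 < log y by rewrite (lt_le_trans ltr01 (log_ge1 _)).
pose u w n := log (running_max Xs n w) / log n%:R.
have u_ge0 w n : 0 <= u w n by rewrite divr_ge0// ltW.
have rho0 := rho1_ge0 X.
have upper : {ae P', forall w, forall a : R, ((rho1 X)^-1 < a%:E)%E ->
    \forall n \near \oo, u w n <= a}.
  (* If 1 / rho is infinite no real [a] exceeds it. Otherwise the values 1 / rho + 1 / (k + 1)
     suffice, so only countably many null sets are joined. *)
  have [rhoV_fin|/negP rhoV_fin] := boolP ((rho1 X)^-1%E \is a fin_num); last first.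
    apply/nearW => w a rho_a; case: rhoV_fin.
    by rewrite ge0_fin_numE ?inve_ge0// (lt_trans rho_a)// ltry.
  have below k : {ae P', forall w,
      \forall n \near \oo, u w n <= fine (rho1 X)^-1 + k.+1%:R^-1}.
    set a := _ + _.
    have a0 : 0 < a by rewrite ltr_wpDl// fine_ge0// inve_ge0.
    have a_rho : (a^-1%:E < rho1 X)%E.
      rewrite -(inveK (rho1 X)) inve_pgt ?inE ?lee_fin ?invr_ge0 ?inve_ge0 ?(ltW a0)//.
      by rewrite inver invr_eq0 gt_eqF// invrK -(fineK rhoV_fin) lte_fin ltrDl.
    have aV0 : 0 < a^-1 by rewrite invr_gt0.
    by have := ae_log_max_ratio_le X Xs Xs_law _ aV0 a_rho; rewrite invrK.
  have := ae_foralln below; apply: filterS => w below_w a.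
  rewrite -(fineK rhoV_fin) lte_fin -subr_gt0 => rho_a.
  have [k _ /(_ k (leqnn _))/= ka] := near_infty_natSinv_lt (PosNum rho_a).
  by apply: filterS (below_w k) => n /le_trans; apply; move: ka; rewrite ltrBrDl => /ltW.
have lower : {ae P', forall w, forall b : R, (b%:E < (rho1 X)^-1)%E ->
    \forall n \near \oo, b <= u w (l n)}.
  have [rho_y|rho_y] := eqVneq (rho1 X) +oo%E; last exact: ae_le_log_max_ratio (lP rho_y).
  apply/nearW => w b; rewrite rho_y invey lte_fin => b0; apply: nearW => n.
  exact: le_trans (ltW b0) _.
have both : {ae P', forall w,
    limn_esup (fun n => log_max_ratio Xs n w) = (rho1 X)^-1%E /\
    log_max_ratio Xs (l n) w @[n --> \oo] --> (rho1 X)^-1%E}.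
  by apply: filterS2 upper lower => w; exact: limn_esup_eq_subseq_lim.
by split; apply: filterS both => w [].
Qed.
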